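(* Let $\mathcal{Z}\subset\mathfrak{C}(\mathbb{E})$ be a nonempty compact set in the Pompeiu-Hausdorff metric $h$ of $\mathfrak{C}(\mathbb{E})$. Let $\{X_n\}_{n=1}^{+\infty}\subset\mathcal{Z}$ and let $C\in\mathfrak{C}_c(\mathbb{E})$. Then $$\frac{\overline{\overline{\mathrm{co}}X_1+\dots+\overline{\mathrm{co}}X_n}}{n}\xrightarrow{F}C\quad\text{as } n\to+\infty$$ implies $$\frac{\overline{X_1+\dots+X_n}}{n}\xrightarrow{F}C\quad\text{as } n\to+\infty.$$
   Context: $\mathbb{E}$ is an arbitrary real Banach space. $\mathfrak{C}(\mathbb{E})$ (resp. $\mathfrak{C}_c(\mathbb{E})$) is the space of nonempty closed bounded (resp. nonempty closed convex bounded) subsets of $\mathbb{E}$. For nonempty bounded $X,Y\subset\mathbb{E}$: $d(x,Y)=\inf_{y\in Y}\|x-y\|$, $e(X,Y)=\sup_{x\in X}d(x,Y)$, $h(X,Y)=\max\{e(X,Y),e(Y,X)\}$ (Pompeiu-Hausdorff metric). $\overline{\mathrm{co}}X$ is the closed convex hull. Sums and scalar multiples of sets are elementwise; the bar denotes norm closure. $X_n\xrightarrow{F}X$ (Fisher convergence) means $\lim_n e(X_n,X)=0$ and $\lim_n d(z,X_n)=0$ for every $z\in X$. *)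

(* Defs.v *)
From HB Require Import structures.
From mathcomp Require Import all_boot all_order all_algebra.
From mathcomp Require Import all_classical all_reals all_analysis.

Set Implicit Arguments.
Unset Strict Implicit.
Unset Printing Implicit Defensive.

Import Order.TTheory GRing.Theory Num.Theory.
Import numFieldNormedType.Exports.

Local Open Scope classical_set_scope.
Local Open Scope ring_scope.

Section set_operations.
Context {R : realType} {E : normedModType R}.
Implicit Types (A B C : set E).

Definition minkowski_add A B : set E := [set x + y | x in A & y in B].

Definition minkowski_scale (a : R) A : set E := [set a *: x | x in A].

Definition closed_convex_hull A : set E :=
  smallest [set B : set E | closed B /\ convex_set B] A.

Lemma minkowski_addA : associative minkowski_add.
Proof.
move=> A B C; apply/seteqP; split => [_ [x Ax [_ [y By [z Cz <-]] <-]]|].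
  by exists (x + y); [exists x => //; exists y|exists z; rewrite ?addrA].
move=> _ [_ [x Ax [y By <-]] [z Cz <-]].
by exists x => //; exists (y + z); [exists y => //; exists z|rewrite addrA].
Qed.

Lemma minkowski_addC : commutative minkowski_add.
Proof.
by move=> A B; apply/seteqP; split => [_ [x Ax [y By <-]]|_ [x Ax [y By <-]]];
  exists y => //; exists x => //; rewrite addrC.
Qed.

Lemma minkowski_add0 : left_id [set 0] minkowski_add.
Proof.
move=> A; apply/seteqP; split => [_ [_ -> [x Ax <-]]|x Ax].
  by rewrite add0r.
by exists 0 => //; exists x; rewrite ?add0r.
Qed.

HB.instance Definition _ := Monoid.isComLaw.Build (set E) [set 0] minkowski_add
  minkowski_addA minkowski_addC minkowski_add0.

End set_operations.

Section pompeiu_hausdorff.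
Context {R : realType} {E : normedModType R}.
Implicit Types (x y z : E) (X Y Z : set E).

(* These are real-valued: `inf` and `sup` have their usual meaning when X and Y
   are nonempty and bounded, the only case in which they are used. *)
Definition dist_to x Y : R := inf [set `|x - y| | y in Y].

Definition excess X Y : R := sup [set dist_to x Y | x in X].

Definition hausdorff_dist X Y : R := Num.max (excess X Y) (excess Y X).

Definition fisher_cvg (X : nat -> set E) (Y : set E) : Prop :=
  excess (X n) Y @[n --> \oo] --> (0 : R) /\
  forall z, Y z -> dist_to z (X n) @[n --> \oo] --> (0 : R).

Lemma dist_to_has_lbound x Y : has_lbound [set `|x - y| | y in Y].
Proof. by exists 0 => _ [y _ <-]. Qed.

Lemma dist_to_le x Y y : Y y -> dist_to x Y <= `|x - y|.
Proof.
by move=> Yy; apply: ge_inf; [exact: dist_to_has_lbound|exists y].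
Qed.

Lemma dist_to_ge x Y (r : R) : Y !=set0 ->
  (forall y, Y y -> r <= `|x - y|) -> r <= dist_to x Y.
Proof.
move=> [y0 Yy0] rY; apply: lb_le_inf; first by exists `|x - y0|, y0.
by move=> _ [y Yy <-]; exact: rY.
Qed.

Lemma dist_to_ge0 x Y : Y !=set0 -> 0 <= dist_to x Y.
Proof. by move=> Y0; exact: dist_to_ge. Qed.

Lemma dist_to_triangle x z Y : Y !=set0 ->
  dist_to x Y <= `|x - z| + dist_to z Y.
Proof.
move=> Y0; rewrite -lerBlDl; apply: dist_to_ge => // y Yy.
by rewrite lerBlDl (le_trans (dist_to_le x Yy))// ler_distD.
Qed.

Lemma dist_to_eq0 x Y : closed Y -> Y !=set0 -> dist_to x Y = 0 -> Y x.
Proof.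
move=> cY Y0 d0; apply: cY => B /nbhs_ballP[r /= r0 xrB].
have : ~ (r <= dist_to x Y) by rewrite d0; apply/negP; rewrite -ltNge.
apply: contra_notP => YB; apply: dist_to_ge => // y Yy.
rewrite leNgt; apply/negP => xyr; apply: YB; exists y; split => //.
by apply: xrB; rewrite -ball_normE.
Qed.

Lemma excess_has_ubound X Y : bounded_set X -> Y !=set0 ->
  has_ubound [set dist_to x Y | x in X].
Proof.
move=> /pinfty_ex_gt0[M M0 XM] [y Yy]; exists (M + `|y|) => _ [x Xx <-].
rewrite (le_trans (dist_to_le _ Yy))// (le_trans (ler_normB _ _))//.
by rewrite lerD2r; exact: XM.
Qed.

Lemma dist_to_excess x X Y : bounded_set X -> Y !=set0 -> X x ->
  dist_to x Y <= excess X Y.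
Proof.
move=> bX Y0 Xx; apply: ub_le_sup; first exact: excess_has_ubound.
by exists x.
Qed.

Lemma excess_le X Y (r : R) : X !=set0 ->
  (forall x, X x -> dist_to x Y <= r) -> excess X Y <= r.
Proof.
move=> [x0 Xx0] Xr; apply: ge_sup; first by exists (dist_to x0 Y), x0.
by move=> _ [x Xx <-]; exact: Xr.
Qed.

Lemma excess_triangle X Y Z :
    X !=set0 -> Y !=set0 -> Z !=set0 -> bounded_set X -> bounded_set Y ->
  excess X Z <= excess X Y + excess Y Z.
Proof.
move=> X0 Y0 Z0 bX bY; apply: excess_le => // x Xx.
rewrite -lerBlDr (le_trans _ (dist_to_excess bX Y0 Xx))//.
apply: dist_to_ge => // y Yy; rewrite lerBlDr.
rewrite (le_trans (dist_to_triangle x y Z0))// lerD2l.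
exact: dist_to_excess.
Qed.

End pompeiu_hausdorff.

Record closed_bounded_set (R : realType) (E : normedModType R) :=
  ClosedBoundedSet {
    cbset :> set E ;
    cbset_neq0 : cbset !=set0 ;
    cbset_closed : closed cbset ;
    cbset_bounded : bounded_set cbset
  }.

Section closed_bounded_set_metric.
Context {R : realType} {E : normedModType R}.
Local Notation cbE := (closed_bounded_set E).
Implicit Types X Y Z : cbE.

HB.instance Definition _ := gen_eqMixin cbE.
HB.instance Definition _ := gen_choiceMixin cbE.

Let h X Y : R := hausdorff_dist X Y.

Let hxx X : h X X = 0.
Proof.
rewrite /h /hausdorff_dist maxxx.
have d0 x : (X : set E) x -> dist_to x X = 0.
  move=> Xx; apply/eqP; rewrite eq_le dist_to_ge0 ?andbT; last first.
    exact: cbset_neq0.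
  by rewrite (le_trans (dist_to_le x Xx))// subrr normr0.
apply/eqP; rewrite eq_le; apply/andP; split.
  by apply: excess_le => [|x /d0 ->//]; exact: cbset_neq0.
have [x Xx] := cbset_neq0 X; rewrite -(d0 x Xx).
by apply: dist_to_excess => //; [exact: cbset_bounded|exact: cbset_neq0].
Qed.

Let excess_sub X Y : h X Y = 0 -> (X : set E) `<=` Y.
Proof.
move=> hXY x Xx; apply: dist_to_eq0.
- exact: cbset_closed.
- exact: cbset_neq0.
apply/eqP; rewrite eq_le dist_to_ge0 ?andbT; last exact: cbset_neq0.
rewrite -hXY le_max dist_to_excess//.
- exact: cbset_bounded.
- exact: cbset_neq0.
Qed.

Let h_sym X Y : h X Y = h Y X.
Proof. by rewrite /h /hausdorff_dist maxC. Qed.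

Let h_eq0 X Y : h X Y = 0 -> X = Y.
Proof.
move=> hXY.
have : (X : set E) = Y.
  by apply/seteqP; split; apply: excess_sub => //; rewrite h_sym.
case: X {hXY} => X ? ? ?; case: Y => Y ? ? ? /= XY; subst Y.
by congr ClosedBoundedSet; exact: Prop_irrelevance.
Qed.

Let h_triangle Y X Z : h X Z <= h X Y + h Y Z.
Proof.
have n0 := @cbset_neq0 R E; have bd := @cbset_bounded R E.
rewrite /h /hausdorff_dist ge_max; apply/andP; split.
  apply: (le_trans (@excess_triangle _ _ X Y Z _ _ _ _ _)) => //.
  by apply: lerD; rewrite le_max lexx.
apply: (le_trans (@excess_triangle _ _ Z Y X _ _ _ _ _)) => //.
by rewrite addrC; apply: lerD; rewrite le_max lexx orbT.
Qed.

HB.instance Definition _ :=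
  isMetric.Build R cbE hxx h_eq0 h_sym h_triangle.

Lemma mdist_closed_bounded_setE X Y : mdist X Y = hausdorff_dist X Y.
Proof. by []. Qed.

End closed_bounded_set_metric.

(* Main.v *)
From HB Require Import structures.
Require Import Defs.
From mathcomp Require Import all_boot all_order all_algebra.
From mathcomp Require Import finmap all_classical all_reals all_analysis.
From mathcomp Require Import ring lra.
Import Order.TTheory GRing.Theory Num.Theory.
Import numFieldNormedType.Exports.
Local Open Scope classical_set_scope.
Local Open Scope ring_scope.

(** Write A_n and B_n for the means of the convexified sets and of the sets
    themselves.  Since B_n is contained in A_n, the excess of B_n over C is at
    most that of A_n, and only the pointwise half of Fisher convergence needs
    an argument: every z in C which is a limit of means of points of the
    closed convex hulls must be a limit of means of points of the X_i.

    In infinite dimension, n copies of a bounded set Y do not in general fill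
    n co Y up to an error o(n) uniform over co Y, so no quantitative
    convexification (Shapley-Folkman, type p) is available.  What saves the
    argument is that for one fixed point w of the closed convex hull of Y the
    error is o(n): the set of such w contains Y and is closed and convex
    ([selectable_closed], [selectable_convex]).  So it is enough to reach z, up
    to a small error, with finitely many fixed points w, reused for all n.

    Compactness provides them.  Fix d > 0.  Up to d only finitely many sets
    occur, that is, the indices can be colored with finitely many colors so
    that sets of the same color are d-close ([compact_color_close]).  The
    vector of color frequencies among the first n indices lives in a compact
    cube, hence n itself can be given finitely many types so that all n of one
    type have nearly the same frequencies ([color_freq_coloring]).  For each
    recurring type choose one large m of that type and points u_i, i < m, of the
    convex hulls whose mean is close to z; replace them by their centroids
    w_l, one for each color l.  For every other n of that type, the points w_l
    weighted by the frequencies at n still have mean close to z, and selecting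
    points of the X_i around n_l copies of w_l costs O(d) + K / n
    ([selection_transfer]).  Finitely many types give a common bound for K, and
    the claim follows ([avg_limit_closed_convex_hull]). *)

(** * Finite colorings from compactness *)

(** A sequence in a compact set meets finitely many small balls; colors stand
    for the balls of a finite cover. *)
Lemma compact_coloring (R : realType) (T : pseudoMetricType R) (A : set T)
    (f : nat -> T) (e : R) : compact A -> (forall i, A (f i)) -> 0 < e ->
  exists k (c : nat -> 'I_k), forall i j, c i = c j -> ball (f i) e (f j).
Proof.
move=> cA Af e0; have e20 : 0 < e / 2 by rewrite divr_gt0.
have [D' _ AD'] : finite_subset_cover A (fun t => (ball t (e / 2))^°) A.
  (* The cover form of compactness is about pointed spaces; any term of the
     sequence serves as the point. *)
  pose pT : ptopologicalType :=
    HB.pack (PseudoMetric.sort T) (isPointed.Build T (f 0)).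
  have := cA : @compact pT A; rewrite compact_cover; apply.
    by move=> *; exact: open_interior.
  by move=> t At; exists t => //; exact: nbhsx_ballx.
have /choice[g gP] : forall i, exists t, t \in D' /\ ball t (e / 2) (f i).
  move=> i; have [t tD' /interior_subset ti] := AD' _ (Af i).
  by exists t.
have gD' i : (index (g i) D' < size D')%N by rewrite index_mem; case: (gP i).
exists (size D'), (fun i => Ordinal (gD' i)) => i j [] gij.
have gE : g i = g j.
  by rewrite -(nth_index (g i) (gP i).1) gij nth_index// (gP j).1.
rewrite (splitr e); apply: (@ball_triangle _ _ (g i)).
  by apply: ball_sym; exact: (gP i).2.
by rewrite gE; exact: (gP j).2.
Qed.

(** * Means, convex sets and closures in a normed space *)

Lemma sumr_const_seq (V : nmodType) (T : Type) (s : seq T) (x : V) :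
  \sum_(i <- s) x = x *+ size s.
Proof. by rewrite big_const_seq count_predT -Monoid.iteropE. Qed.

Section convex_closed.
Context {R : realType} {E : normedModType R}.
Implicit Types (A : set E) (x y w : E).

Lemma convex_setP A : convex_set A <->
  forall x y (t : R), 0 <= t <= 1 -> A x -> A y -> A (t *: x + (1 - t) *: y).
Proof.
split=> [cA x y t t01 Ax Ay|cA x y l].
  have := cA x y (Itv01 (andP t01).1 (andP t01).2).
  by rewrite !inE; apply.
rewrite !inE => Ax Ay; apply: cA => //.
by rewrite ge0 le1.
Qed.

Lemma closure_approxP A w :
  closure A w <-> forall e : R, 0 < e -> exists2 y, A y & `|w - y| < e.
Proof.
split=> [clw e e0|Aw B /nbhs_ballP[e /= e0 wB]].
  have [y [Ay]] := clw _ (nbhsx_ballx w e e0).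
  by rewrite -ball_normE /= => wy; exists y.
have [y Ay wy] := Aw _ e0; exists y; split => //.
by apply: wB; rewrite -ball_normE.
Qed.

Lemma convex_set_mean A (s : seq nat) (u : nat -> E) : convex_set A ->
  (0 < size s)%N -> (forall i, i \in s -> A (u i)) ->
  A ((size s)%:R^-1 *: \sum_(i <- s) u i).
Proof.
move=> /convex_setP cA; elim: s => // i [_ _ uA|j s ih _ uA].
  by rewrite big_seq1 invr1 scale1r; apply: uA; rewrite mem_head.
rewrite big_cons; set n := size (j :: s).
have n0 : n%:R != 0 :> R by rewrite pnatr_eq0.
have n10 : n.+1%:R != 0 :> R by rewrite pnatr_eq0.
have -> : (size (i :: j :: s))%:R^-1 *: (u i + \sum_(l <- j :: s) u l) =
    n.+1%:R^-1 *: u i + (1 - n.+1%:R^-1) *: (n%:R^-1 *: \sum_(l <- j :: s) u l).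
  rewrite scalerDr scalerA; congr (_ + _ *: _).
  rewrite /= -/n; rewrite -natr1 in n10 *; field; exact/andP.
apply: cA; first by rewrite invr_ge0 ler0n invf_le1 ?ltr0n// ler1n.
  by apply: uA; rewrite mem_head.
by apply: ih => // l ls; apply: uA; rewrite inE ls orbT.
Qed.

Lemma closed_convex_hull_le A (M : R) : (forall x, A x -> `|x| <= M) ->
  forall x, closed_convex_hull A x -> `|x| <= M.
Proof.
move=> AM; apply: (@smallest_sub _ _ _ [set x | `|x| <= M]) => //; split.
  move=> x /closure_approxP xM; apply/ler_addgt0Pr => e e0.
  have [y /= yM xy] := xM _ e0; rewrite -(subrK y x) addrC.
  by rewrite (le_trans (ler_normD _ _))// lerD// ltW.
apply/convex_setP => x y t /andP[t0 t1] /= xM yM.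
rewrite (le_trans (ler_normD _ _))// !normrZ ger0_norm// ger0_norm ?subr_ge0//.
by nra.
Qed.

End convex_closed.

(** * Approximating multiples of a point of the convex hull *)

Section selection.
Context {R : realType} {E : normedModType R}.
Implicit Types (X : nat -> set E) (I : pred nat) (d : R).

(** Sums of selections over s stay within d * n + o(n) of n w, n being the
    size of s.  The o(n) is spelled e * n + K, which makes the set closed, and
    K may depend on w: an estimate uniform over a convex hull fails in
    general. *)
Definition selectable X I d : set E :=
  [set w | forall e : R, 0 < e -> exists K : R, forall s : seq nat,
     uniq s -> all I s -> exists2 x : nat -> E,
       forall i, i \in s -> X i (x i) &
       `|\sum_(i <- s) (x i - w)| <= (d + e) * (size s)%:R + K].

(** Replacing w by a point at distance e / 2 changes the sum by at most
    n * e / 2, leaving half of e for the approximation of that point. *)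
Lemma selectable_closed X I d : closed (selectable X I d).
Proof.
move=> w /closure_approxP wS e e0; have e20 : 0 < e / 2 by rewrite divr_gt0.
have [w' /(_ _ e20)[K KP] ww'] := wS _ e20.
exists K => s us Is; have [x xX xK] := KP s us Is; exists x => //.
have -> : \sum_(i <- s) (x i - w) =
    \sum_(i <- s) (x i - w') + (w' - w) *+ size s.
  rewrite -sumr_const_seq -big_split/=; apply: eq_bigr => i _.
  by rewrite addrA subrK.
rewrite (le_trans (ler_normD _ _))// (splitr e) addrA mulrDl addrAC.
rewrite lerD// normrMn -[leLHS]mulr_natr ler_wpM2r// distrC; exact: ltW.
Qed.

(** To approximate t a + (1 - t) b, split s into a part of size
    floor (t * size s), used for a, and the rest, used for b; rounding costs at
    most the constant |a - b|, which goes into K. *)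
Lemma selectable_convex X I d : convex_set (selectable X I d).
Proof.
apply/convex_setP => a b t /andP[t0 t1] Sa Sb e e0.
have [Ka KaP] := Sa _ e0; have [Kb KbP] := Sb _ e0.
exists (Ka + Kb + `|a - b|) => s us Is.
set N := size s; set n := Num.truncn (t * N%:R).
have tN0 : 0 <= t * N%:R by rewrite mulr_ge0.
have /andP[nl nu] := truncn_itv tN0; rewrite -/n in nl nu.
have nN : (n <= N)%N.
  by rewrite -(ler_nat R) (le_trans nl)// ler_piMl.
set s1 := take n s; set s2 := drop n s.
have sE : s = s1 ++ s2 by rewrite cat_take_drop.
have := us; rewrite sE cat_uniq => /and3P[us1 /hasPn s12 us2].
have := Is; rewrite sE all_cat => /andP[Is1 Is2].
have [xa xaX xaK] := KaP _ us1 Is1; have [xb xbX xbK] := KbP _ us2 Is2.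
exists (fun i => if i \in s1 then xa i else xb i) => [i|].
  rewrite mem_cat; case: ifPn => [/xaX//|_ /= /xbX//].
set w := t *: a + _.
have sz1 : size s1 = n by rewrite size_takel.
have sz2 : size s2 = (N - n)%N by rewrite size_drop.
(* The last summand is the rounding error: t N copies of a are wanted and n
   are used. *)
have -> : \sum_(i <- s1 ++ s2) ((if i \in s1 then xa i else xb i) - w) =
   \sum_(i <- s1) (xa i - a) + \sum_(i <- s2) (xb i - b) +
   (n%:R - t * N%:R) *: (a - b).
  rewrite big_cat/= (eq_big_seq (fun i => (xa i - a) + (a - w))); last first.
    by move=> i ->; rewrite addrA subrK.
  rewrite [X in _ + X](eq_big_seq (fun i => (xb i - b) + (b - w))); last first.
    by move=> i /s12/negbTE ->; rewrite addrA subrK.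
  rewrite [X in X + _ = _]big_split [X in _ + X = _]big_split/=.
  rewrite !sumr_const_seq sz1 sz2 addrACA; congr (_ + _).
  have -> : a - w = (1 - t) *: (a - b).
    by rewrite /w opprD addrA -{1}(scale1r a) -scalerBl -scalerBr.
  have -> : b - w = - t *: (a - b).
    rewrite /w opprD addrCA -{1}(scale1r b) -scalerBl subKr.
    by rewrite scaleNr scalerBr opprB addrC.
  rewrite -[X in X + _ = _]scaler_nat -[X in _ + X = _]scaler_nat.
  rewrite !scalerA -scalerDl; congr (_ *: _).
  by rewrite (natrB _ nN); move: n%:R N%:R => p q; ring.
rewrite (le_trans (ler_normD _ _))// addrA lerD//; last first.
  rewrite normrZ -[leRHS]mul1r ler_wpM2r// ler_norml.
  move: nu; rewrite -natr1 => nu.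
  move: n%:R N%:R nl nu => p q nl nu; apply/andP; split; lra.
rewrite (le_trans (ler_normD _ _))// (le_trans (lerD xaK xbK))//.
by rewrite sz1 sz2 (natrB _ nN); move: n%:R N%:R => p q; lra.
Qed.

(** A point of X j itself is selectable with K = 0, since each X i contains a
    point at distance at most d from it; closed convex sets containing X j
    contain its closed convex hull. *)
Lemma closed_convex_hull_selectable X I d j : 0 <= d ->
  (forall i x, I i -> X j x -> exists2 y, X i y & `|x - y| <= d) ->
  closed_convex_hull (X j) `<=` selectable X I d.
Proof.
move=> d0 IX; apply: smallest_sub.
  by split; [exact: selectable_closed|exact: selectable_convex].
move=> w Xw e e0; exists 0 => s us /allP Is.
have /choice[x xP] : forall i, exists y, I i -> X i y /\ `|w - y| <= d.
  move=> i; have [Ii|] := boolP (I i); last by exists 0.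
  by have [y Xy wy] := IX i w Ii Xw; exists y.
exists x => [i /Is /xP[]//|].
rewrite addr0 (le_trans (ler_norm_sum _ _ _))// mulr_natr.
rewrite -sumr_const_seq big_seq [leRHS]big_seq ler_sum// => i /Is /xP[_].
by rewrite distrC => /le_trans; apply; rewrite lerDl ltW.
Qed.

End selection.

(** * Color classes and their frequencies *)

Section transfer.
Context {R : realType} {E : normedModType R}.
Implicit Types (X : nat -> set E) (d M : R) (k : nat).

Definition color_class {k} (c : nat -> 'I_k) (n : nat) (l : 'I_k) : seq nat :=
  [seq i <- index_iota 0 n | c i == l].

Definition color_freq {k} (c : nat -> 'I_k) (n : nat) : 'rV[R]_k :=
  \row_l ((size (color_class c n l))%:R / n%:R).

Lemma sum_color_class {V : nmodType} {k} (c : nat -> 'I_k) n (F : nat -> V) :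
  \sum_(0 <= i < n) F i = \sum_l \sum_(i <- color_class c n l) F i.
Proof.
rewrite (partition_big c predT)//=; apply: eq_bigr => l _.
by rewrite [RHS]big_filter.
Qed.

Lemma sum_size_color_class {k} (c : nat -> 'I_k) n :
  (\sum_l size (color_class c n l) = n)%N.
Proof.
rewrite -[RHS](subn0 n) -[RHS]muln1 -sum_nat_const_nat (sum_color_class c n).
by apply: eq_bigr => l _; rewrite sum1_size.
Qed.

Lemma color_freq_ge0_le1 {k} (c : nat -> 'I_k) n l :
  0 <= color_freq c n ord0 l <= 1.
Proof.
rewrite mxE divr_ge0//=; case: n => [|n]; first by rewrite invr0 mulr0.
rewrite ler_pdivrMr ?ltr0n// mul1r ler_nat.
by rewrite -[leqRHS](sum_size_color_class c) (bigD1 l)//= leq_addr.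
Qed.

(** * Transferring a mean from one length to another *)

Definition color_close {k} X (c : nat -> 'I_k) d := forall i j, c i = c j ->
  forall x, X i x -> exists2 y, X j y & `|x - y| <= d.

(** The centroid of the points u i of color l.  A color absent below m may
    still occur later, and then any point of a set of that color will do: its
    weight at m is zero. *)
Lemma color_centroid {k} (c : nat -> 'I_k) X d M m (u : nat -> E) l :
  0 <= d -> 0 <= M -> (forall i, X i !=set0) ->
  (forall i x, X i x -> `|x| <= M) -> color_close X c d ->
  (forall i, (i < m)%N -> closed_convex_hull (X i) (u i)) ->
  exists w, [/\ `|w| <= M, selectable X [pred i | c i == l] d w &
    \sum_(i <- color_class c m l) u i = (size (color_class c m l))%:R *: w].
Proof.
move=> d0 M0 X0 XM cX uX; have [s0|] := posnP (size (color_class c m l)).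
  rewrite (size0nil s0) !big_nil.
  have [[i ci]|Nc] := pselect (exists i, c i = l).
    have [x Xx] := X0 i; exists x; split; [exact: XM Xx| |by rewrite scale0r].
    apply: (@closed_convex_hull_selectable _ _ X _ d i) => //; last first.
      exact: sub_gen_smallest.
    by move=> j y /eqP cj; apply: cX; rewrite ci.
  exists 0; split; [by rewrite normr0| |by rewrite scaler0].
  move=> e e0; exists 0 => -[|i s] _; last first.
    by move=> /= /andP[/eqP ci]; case: Nc; exists i.
  by move=> _; exists (fun=> 0) => //; rewrite big_nil normr0 mulr0 addr0.
set s := color_class c m l => s0; exists ((size s)%:R^-1 *: \sum_(i <- s) u i).
have sP i : i \in s -> c i = l /\ (i < m)%N.
  by rewrite mem_filter mem_index_iota => /andP[/eqP -> /andP[]].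
split; last by rewrite scalerA divff ?scale1r// pnatr_eq0 -lt0n.
  rewrite normrZ normfV normr_nat ler_pdivrMl ?ltr0n// mulr_natl.
  rewrite (le_trans (ler_norm_sum _ _ _))// -sumr_const_seq.
  rewrite big_seq [leRHS]big_seq ler_sum// => i /sP[_ im].
  by apply: closed_convex_hull_le (uX _ im); exact: XM.
apply: convex_set_mean => //; first exact: selectable_convex.
move=> i /sP[ci im]; apply: closed_convex_hull_selectable (uX _ im) => //.
by move=> j y /eqP cj; apply: cX; rewrite ci.
Qed.

(** With w_l the centroids of the points u i, the mean at m is the sum of the
    w_l weighted by the color frequencies at m.  Passing to the frequencies at
    n costs at most k b M, and selecting points of the X i for the weights at n
    costs 2 d + K / n by selectability of the w_l, K being the sum of the
    constants attached to them. *)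
Lemma selection_transfer {k} (c : nat -> 'I_k) X d M (b : R) m (u : nat -> E) :
  0 < d -> 0 <= M -> (forall i, X i !=set0) ->
  (forall i x, X i x -> `|x| <= M) -> color_close X c d -> (0 < m)%N ->
  (forall i, (i < m)%N -> closed_convex_hull (X i) (u i)) ->
  exists K : R, forall n, (0 < n)%N ->
    (forall l, `|color_freq c m ord0 l - color_freq c n ord0 l| <= b) ->
    exists2 x : nat -> E, forall i, (i < n)%N -> X i (x i) &
      `|m%:R^-1 *: \sum_(0 <= i < m) u i - n%:R^-1 *: \sum_(0 <= i < n) x i|
        <= k%:R * (b * M) + (d + d) + K / n%:R.
Proof.
move=> d0 M0 X0 XM cX m0 uX.
have /choice[w wP] := fun l =>
  color_centroid c X d M m u l (ltW d0) M0 X0 XM cX uX.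
have /choice[K KP] : forall l, exists K : R, forall s : seq nat, uniq s ->
    all [pred i | c i == l] s -> exists2 x : nat -> E,
      forall i, i \in s -> X i (x i) &
      `|\sum_(i <- s) (x i - w l)| <= (d + d) * (size s)%:R + K.
  by move=> l; have [_ /(_ d d0)] := wP l.
exists (\sum_l K l) => n n0 bP.
have nR0 : n%:R != 0 :> R by rewrite pnatr_eq0 -lt0n.
have /choice[x xP] : forall l, exists x : nat -> E,
    (forall i, i \in color_class c n l -> X i (x i)) /\
    `|\sum_(i <- color_class c n l) (x i - w l)| <=
      (d + d) * (size (color_class c n l))%:R + K l.
  move=> l; have [||x ? ?] := KP l (color_class c n l); last by exists x.
    by rewrite filter_uniq// iota_uniq.
  exact: filter_all.
exists (fun i => x (c i) i) => [i ni|].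
  apply: (xP (c i)).1; rewrite mem_filter eqxx.
  by rewrite mem_index_iota.
rewrite (sum_color_class c m) (sum_color_class c n).
have -> : \sum_l \sum_(i <- color_class c m l) u i =
    \sum_l (size (color_class c m l))%:R *: w l.
  by apply: eq_bigr => l _; case: (wP l).
have -> : \sum_l \sum_(i <- color_class c n l) x (c i) i =
    \sum_l (size (color_class c n l))%:R *: w l +
    \sum_l \sum_(i <- color_class c n l) (x l i - w l).
  rewrite -big_split/=; apply: eq_bigr => l _.
  rewrite scaler_nat -sumr_const_seq -big_split/=; apply: eq_big_seq => i.
  by rewrite mem_filter => /andP[/eqP -> _]; rewrite addrC subrK.
rewrite scalerDr opprD addrA (le_trans (ler_normB _ _))// -addrA lerD//.
  rewrite !scaler_sumr -sumrB (le_trans (ler_norm_sum _ _ _))//.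
  have -> : k%:R * (b * M) = \sum_(l < k) b * M.
    by rewrite sumr_const card_ord mulr_natl.
  rewrite ler_sum// => l _.
  rewrite !scalerA -scalerBl normrZ ler_pM//; last by case: (wP l).
  by have := bP l; rewrite !mxE ![_ / _]mulrC.
rewrite normrZ normfV normr_nat mulrC ler_pdivrMr ?ltr0n//.
rewrite mulrDl mulfVK// (le_trans (ler_norm_sum _ _ _))//.
have -> : n%:R = \sum_l (size (color_class c n l))%:R :> R.
  by rewrite -natr_sum sum_size_color_class.
by rewrite mulr_sumr -big_split/= ler_sum// => l _; exact: (xP l).2.
Qed.

(** The frequency vectors lie in the compact cube [0, 1]^k. *)
Lemma color_freq_coloring {k} (c : nat -> 'I_k) (b : R) : 0 < b ->
  exists k' (g : nat -> 'I_k'), forall m n, g m = g n ->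
    forall l, `|color_freq c m ord0 l - color_freq c n ord0 l| <= b.
Proof.
move=> b0.
have cA := @rV_compact R k _ (fun=> @segment_compact R 0 1).
have cP n : [set v : 'rV[R]_k | forall l, `[0, 1]%classic (v ord0 l)]
    (color_freq c n).
  by move=> l /=; rewrite in_itv/= color_freq_ge0_le1.
have [k' [g gP]] := compact_coloring _ _ _ _ _ cA cP b0.
exists k', g => m n /gP[_ mn] l; have := mn ord0 l.
by rewrite -ball_normE => /ltW.
Qed.

(** The pointwise half of Fisher convergence of the means to a set containing
    z, in terms of points: see [dist_minkowski_mean_cvg0]. *)
Definition avg_limit X (z : E) := forall e : R, 0 < e ->
  \forall n \near \oo, exists2 u : nat -> E,
    (forall i, (i < n)%N -> X i (u i)) &
    `|z - n%:R^-1 *: \sum_(0 <= i < n) u i| < e.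

(** Every n > N is handled by a length m > N of the same frequency type chosen
    once for all; the constant K then takes finitely many values, and K / n
    tends to zero. *)
Lemma avg_limit_closed_convex_hull X M : 0 <= M -> (forall i, X i !=set0) ->
  (forall i x, X i x -> `|x| <= M) ->
  (forall d, 0 < d -> exists k (c : nat -> 'I_k), color_close X c d) ->
  avg_limit (fun i => closed_convex_hull (X i)) `<=` avg_limit X.
Proof.
move=> M0 X0 XM cX z zX e e0; set d := e / 6.
have d0 : 0 < d by rewrite divr_gt0.
(* The final error is at most 5 d: d for the mean of u, then d for the
   frequencies, 2 d for the selection and d for K / n. *)
have [k [c ck]] := cX d d0.
(* Adding 1 avoids a zero denominator when M = 0. *)
set b := d / (k%:R * M + 1).
have kM : 0 <= k%:R * M by rewrite mulr_ge0.
have kM1 : 0 < k%:R * M + 1 by rewrite ltr_wpDl.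
have b0 : 0 < b by rewrite divr_gt0.
have kbM : k%:R * (b * M) <= d.
  by rewrite mulrCA /b mulrAC ler_pdivrMr// ler_pM2l// lerDl.
have [k' [g gP]] := color_freq_coloring c b b0.
have [N _ NP] := zX d d0.
have /choice[K KP] : forall l : 'I_k', exists K : R, forall n, (N < n)%N ->
    g n = l -> exists2 x : nat -> E, forall i, (i < n)%N -> X i (x i) &
      `|z - n%:R^-1 *: \sum_(0 <= i < n) x i| <= 4 * d + K / n%:R.
  move=> l.
  have [[m [Nm gm]]|Nl] := pselect (exists m, (N < m)%N /\ g m = l);
    last by exists 0 => n Nn gn; case: Nl; exists n.
  have [u uX zu] := NP m (ltnW Nm).
  have m0 : (0 < m)%N := leq_ltn_trans (leq0n _) Nm.
  have [K KP] := selection_transfer c X d M b m u d0 M0 X0 XM ck m0 uX.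
  exists K => n Nn gn.
  have [|x xX ux] := KP n (leq_ltn_trans (leq0n _) Nn).
    by apply: gP; rewrite gm gn.
  exists x => //.
  apply: le_trans (ler_distD (m%:R^-1 *: \sum_(0 <= i < m) u i) _ _) _.
  by apply: le_trans (lerD (ltW zu) ux) _; lra.
have Kn : \forall n \near \oo, (\sum_l `|K l|) < d * n%:R.
  near=> n; rewrite mulrC -ltr_pdivrMr//.
  by near: n; exact: nbhs_infty_gtr.
near=> n; have n0 : (0 < n)%N by near: n; exact: nbhs_infty_gt.
have [|x xX zx] := KP (g n) n _ erefl.
  by near: n; exact: nbhs_infty_gt.
exists x => //; apply: le_lt_trans zx _.
have : K (g n) / n%:R < d.
  rewrite ltr_pdivrMr ?ltr0n//; apply: le_lt_trans (near Kn n _) => //.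
  rewrite (le_trans (ler_norm _))// (bigD1 (g n))//= lerDl sumr_ge0//.
by rewrite /d; lra.
Unshelve. all: by end_near. Qed.

End transfer.

(** * Minkowski means *)

Section minkowski_mean.
Context {R : realType} {E : normedModType R}.
Implicit Types (F : nat -> set E) (A : set E) (z : E).

Lemma minkowski_sumP F n v :
  (\big[minkowski_add/[set 0]]_(0 <= i < n) F i) v <->
  exists2 u : nat -> E, (forall i, (i < n)%N -> F i (u i)) &
    v = \sum_(0 <= i < n) u i.
Proof.
split.
  elim: n v => [v|n ih v].
    by rewrite big_geq// => ->; exists (fun=> 0) => //; rewrite big_geq.
  rewrite big_nat_recr//= => -[_ /ih[u uF ->] [y Fy <-]].
  exists (fun i => if (i < n)%N then u i else y) => [i|].
    rewrite ltnS leq_eqVlt => /predU1P[->|ni]; first by rewrite ltnn.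
    by rewrite ni; exact: uF.
  rewrite big_nat_recr//= ltnn; congr (_ + _).
  by apply: eq_big_nat => i /andP[_ ->].
move=> [u uF ->]; elim: n uF => [_|n ih uF]; first by rewrite !big_geq.
rewrite !big_nat_recr//=; exists (\sum_(0 <= i < n) u i).
  by apply: ih => i ni; apply: uF; exact: leqW.
by exists (u n) => //; exact: uF.
Qed.

Definition minkowski_mean F n : set E :=
  minkowski_scale n%:R^-1
    (closure (\big[minkowski_add/[set 0]]_(0 <= i < n) F i)).

Lemma minkowski_mean_avg F n (u : nat -> E) :
  (forall i, (i < n)%N -> F i (u i)) ->
  minkowski_mean F n (n%:R^-1 *: \sum_(0 <= i < n) u i).
Proof.
move=> uF; exists (\sum_(0 <= i < n) u i) => //.
by apply: subset_closure; apply/minkowski_sumP; exists u.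
Qed.

Lemma minkowski_mean_approx F n z e : minkowski_mean F n z -> 0 < e ->
  exists2 u : nat -> E, (forall i, (i < n)%N -> F i (u i)) &
    `|z - n%:R^-1 *: \sum_(0 <= i < n) u i| < e.
Proof.
move=> [v clv <-] e0; have := clv; rewrite closure_approxP => /(_ e e0).
move=> [_ /minkowski_sumP[u uF ->] vu]; exists u => //.
rewrite -scalerBr normrZ normfV normr_nat; apply: le_lt_trans vu.
case: n {clv uF} => [|n]; first by rewrite invr0 mul0r.
by rewrite ler_piMl// invf_le1 ?ltr0n// ler1n.
Qed.

Lemma minkowski_mean_neq0 F n : (forall i, F i !=set0) ->
  minkowski_mean F n !=set0.
Proof.
move=> /choice[u uF]; exists (n%:R^-1 *: \sum_(0 <= i < n) u i).
exact: minkowski_mean_avg.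
Qed.

Lemma minkowski_mean_sub F G n : (forall i, F i `<=` G i) ->
  minkowski_mean F n `<=` minkowski_mean G n.
Proof.
move=> FG _ [v clv <-]; exists v => //; apply: closureS clv => w.
move=> /minkowski_sumP[u uF ->]; apply/minkowski_sumP.
by exists u => // i /uF/FG.
Qed.

Lemma minkowski_mean_le F n (M : R) : 0 <= M ->
  (forall i x, F i x -> `|x| <= M) ->
  forall x, minkowski_mean F n x -> `|x| <= M.
Proof.
move=> M0 FM x xF; apply/ler_addgt0Pr => e e0.
have [u uF xu] := minkowski_mean_approx _ _ _ _ xF e0.
rewrite -(subrK (n%:R^-1 *: \sum_(0 <= i < n) u i) x) addrC.
rewrite (le_trans (ler_normD _ _))// lerD ?(ltW xu)//.
case: n {xF} uF {xu} => [|n] uF; first by rewrite invr0 scale0r normr0.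
rewrite normrZ normfV normr_nat ler_pdivrMl ?ltr0n//.
rewrite (le_trans (ler_norm_sum _ _ _))// mulr_natl -[X in _ *+ X]subn0.
rewrite -sumr_const_nat big_nat [leRHS]big_nat ler_sum// => i /andP[_ ni].
by apply: FM (uF _ ni).
Qed.

Lemma dist_minkowski_mean_cvg0 F z : (forall i, F i !=set0) ->
  (dist_to z (minkowski_mean F n) @[n --> \oo] --> (0 : R)) <-> avg_limit F z.
Proof.
move=> F0; split=> [/cvgrPdist_lt dF e e0|zF].
  have e20 : 0 < e / 2 by rewrite divr_gt0.
  apply: filterS (dF _ e20) => n; rewrite distrC subr0 => zn.
  have [a Fa za] : exists2 a, minkowski_mean F n a & `|z - a| < e / 2.
    apply/not_exists2P => Nza; move: zn; apply/negP; rewrite -leNgt.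
    rewrite (le_trans _ (ler_norm _))//.
    apply: dist_to_ge; first exact: minkowski_mean_neq0.
    by move=> y Fy; rewrite leNgt; apply/negP; case: (Nza y).
  have [u uF au] := minkowski_mean_approx _ _ _ _ Fa e20.
  exists u => //; rewrite (splitr e).
  by apply: le_lt_trans (ler_distD a _ _) _; exact: ltrD.
apply/cvgrPdist_lt => e e0; apply: filterS (zF e e0) => n [u uF zu].
rewrite distrC subr0 ger0_norm ?dist_to_ge0//; last exact: minkowski_mean_neq0.
by apply: le_lt_trans zu; apply: dist_to_le; exact: minkowski_mean_avg.
Qed.

End minkowski_mean.

(** * Excess *)

Section excess.
Context {R : realType} {E : normedModType R}.
Implicit Types (A B C : set E).

Lemma excess_ge0 A C : A !=set0 -> bounded_set A -> C !=set0 -> 0 <= excess A C.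
Proof.
move=> [a Aa] bA C0.
exact: le_trans (dist_to_ge0 _ C0) (dist_to_excess bA C0 Aa).
Qed.

Lemma le_excess A B C : A `<=` B -> A !=set0 -> bounded_set B -> C !=set0 ->
  excess A C <= excess B C.
Proof.
move=> AB A0 bB C0; apply: excess_le => // x /AB Bx; exact: dist_to_excess.
Qed.

Lemma excess_lt_near A B (d : R) : bounded_set A -> B !=set0 ->
  excess A B < d -> forall x, A x -> exists2 y, B y & `|x - y| < d.
Proof.
move=> bA B0 ABd x Ax; apply/not_exists2P => Nxy; move: ABd.
apply/negP; rewrite -leNgt (le_trans _ (dist_to_excess bA B0 Ax))//.
by apply: dist_to_ge => // y By; rewrite leNgt; apply/negP; case: (Nxy y).
Qed.

Lemma bounded_set_le A (M : R) : (forall x, A x -> `|x| <= M) -> bounded_set A.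
Proof.
move=> AM; exists M; split; first exact: num_real.
by move=> K MK x /AM/le_trans; apply; exact: ltW.
Qed.

End excess.

(** * Compact families of closed bounded sets *)

Section compact_family.
Context {R : realType} {E : normedModType R}.

Lemma compact_color_close (Z : set (closed_bounded_set E))
    (X : nat -> closed_bounded_set E) (d : R) : compact Z ->
  (forall i, Z (X i)) -> 0 < d ->
  exists k (c : nat -> 'I_k), color_close (fun i => X i : set E) c d.
Proof.
move=> cZ XZ d0; have [k [c cP]] := compact_coloring _ _ _ _ _ cZ XZ d0.
exists k, c => i j /cP; rewrite ballEmdist /= mdist_closed_bounded_setE.
rewrite gt_max => /andP[ij _] x Xx.
have [||y Xy xy] := excess_lt_near _ _ _ _ _ ij x Xx.
- exact: cbset_bounded.
- exact: cbset_neq0.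
by exists y => //; exact: ltW.
Qed.

(** A common bound: finitely many colors, and the sets of one color lie within
    d of any one of them. *)
Lemma color_close_bounded {k} (c : nat -> 'I_k) (X : nat -> set E) (d : R) :
  color_close X c d -> (forall i, bounded_set (X i)) ->
  exists2 M : R, 0 <= M & forall i x, X i x -> `|x| <= M.
Proof.
move=> cX bX.
have /choice[M MP] : forall l, exists M : R, forall i x,
    c i = l -> X i x -> `|x| <= M.
  move=> l; have [[j cj]|Nl] := pselect (exists j, c j = l); last first.
    by exists 0 => i x ci; case: Nl; exists i.
  have /pinfty_ex_gt0[M _ MP] := bX j.
  exists (d + M) => i x ci Xx; have [|y Xy xy] := cX i j _ x Xx.
    by rewrite cj.
  by rewrite -(subrK y x) (le_trans (ler_normD _ _))// lerD//; exact: MP.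
exists (\sum_l `|M l|) => [|i x Xx]; first exact: sumr_ge0.
rewrite (le_trans (MP _ i x erefl Xx))// (le_trans (ler_norm _))//.
by rewrite (bigD1 (c i))//= lerDl sumr_ge0.
Qed.

End compact_family.

(** * Fisher convergence of means *)

Theorem theorem4p1 (R : realType) (E : completeNormedModType R)
    (Z : set (closed_bounded_set E)) (Z_neq0 : Z !=set0) (Z_compact : compact Z)
    (X : nat -> closed_bounded_set E) (X_in_Z : forall n, (1 <= n)%N -> Z (X n))
    (C : closed_bounded_set E) (C_convex : convex_set (C : set E)) :
  fisher_cvg
    (fun n => minkowski_scale n%:R^-1
      (closure (\big[minkowski_add/[set 0]]_(1 <= i < n.+1)
                  closed_convex_hull (X i)))) C ->
  fisher_cvg
    (fun n => minkowski_scale n%:R^-1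
      (closure (\big[minkowski_add/[set 0]]_(1 <= i < n.+1) (X i : set E)))) C.
Proof.
(* Shifting to sums from 0 also removes the term X 0, which need not be in Z. *)
pose Y i : set E := X i.+1.
pose coY i := closed_convex_hull (Y i).
have -> : (fun n => minkowski_scale n%:R^-1
    (closure (\big[minkowski_add/[set 0]]_(1 <= i < n.+1)
      closed_convex_hull (X i)))) = minkowski_mean coY.
  by apply/funext => n; rewrite big_add1.
have -> : (fun n => minkowski_scale n%:R^-1
    (closure (\big[minkowski_add/[set 0]]_(1 <= i < n.+1) (X i : set E)))) =
    minkowski_mean Y.
  by apply/funext => n; rewrite big_add1.
have Y0 i : Y i !=set0 by exact: cbset_neq0.
have YcoY i : Y i `<=` coY i by exact: sub_gen_smallest.
have coY0 i : coY i !=set0 by have [y /YcoY] := Y0 i; exists y.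
have Ycolor (d : R) : 0 < d -> exists k (c : nat -> 'I_k), color_close Y c d.
  by apply: (compact_color_close Z (fun i => X i.+1)) => // i; exact: X_in_Z.
have [M M0 YM] : exists2 M : R, 0 <= M & forall i y, Y i y -> `|y| <= M.
  have [k [c cY]] := Ycolor 1 ltr01.
  by apply: color_close_bounded cY _ => i; exact: cbset_bounded.
have coYM n x : minkowski_mean coY n x -> `|x| <= M.
  apply: minkowski_mean_le => // i; exact: closed_convex_hull_le (YM i).
have bcoY n : bounded_set (minkowski_mean coY n).
  exact: bounded_set_le (coYM n).
have Ysub n : minkowski_mean Y n `<=` minkowski_mean coY n.
  exact: minkowski_mean_sub.
move=> [excess_coY dist_coY]; split; last first.
  move=> z Cz; apply/dist_minkowski_mean_cvg0 => //.
  apply: (avg_limit_closed_convex_hull Y M) => //.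
  by apply/dist_minkowski_mean_cvg0 => //; exact: dist_coY.
apply: (squeeze_cvgr _ (@cvg_cst _ (0 : R) _ _ _) excess_coY).
apply: nearW => n; apply/andP; split.
  apply: excess_ge0; [exact: minkowski_mean_neq0| |exact: cbset_neq0].
  by apply: (bounded_set_le _ M) => x /Ysub/coYM.
apply: le_excess => //; [exact: minkowski_mean_neq0|exact: cbset_neq0].
Qed.
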